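(* Let $\Omega$ be a mixing basic set of an Axiom A diffeomorphism $f$, with Markov partition $\mathcal{R}$ and transition matrix $A$. Then $$h_{\mathrm{top}}(f|_\Omega)=h_{\mathrm{top}}(\sigma|_{\Sigma_A})=\log\rho(A),$$ where $\rho(A)$ is the spectral radius of $A$.
   Context: A compact $f$-invariant set is hyperbolic if there is a continuous $Df$-invariant splitting $E^s\oplus E^u$ of the tangent bundle over it and constants $c>0,\lambda\in(0,1)$ with $\|Df^n_xv\|\le c\lambda^n\|v\|$ for $v\in E^s_x$ and $\|Df^{-n}_xv\|\le c\lambda^n\|v\|$ for $v\in E^u_x$, $n\ge0$. A $C^r$ diffeomorphism ($r\ge1$) of a compact Riemannian manifold satisfies Axiom A if its nonwandering set $\Omega(f)$ is hyperbolic and periodic points are dense in it. Basic sets are the members of the unique finite decomposition of $\Omega(f)$ into pairwise disjoint closed $f$-invariant sets on which $f$ is topologically transitive (each further being a finite disjoint union of closed sets cyclically permuted by $f$ on which the return power of $f$ is topologically mixing). A basic set $\Omega$ is mixing if $f|_\Omega$ is topologically mixing. $W^s_\varepsilon(x)=\{y: d(f^n(x),f^n(y))\le\varepsilon\ \forall n\ge0\}$, $W^u_\varepsilon(x)=\{y: d(f^{-n}(x),f^{-n}(y))\le\varepsilon\ \forall n\ge0\}$. A small $\varepsilon$ and $\delta_0>0$ are fixed such that for $x,y\in\Omega$ with $d(x,y)<\delta_0$, $W^s_\varepsilon(x)\cap W^u_\varepsilon(y)$ is a single point $[x,y]\in\Omega$. $R\subset\Omega$ is a rectangle if $\mathrm{diam}(R)<\delta_0$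 and $[x,y]\in R$ for all $x,y\in R$; it is proper if closed and $R=\overline{\mathrm{int}(R)}$ (interior in $\Omega$). $W^s(x,R)=W^s_\varepsilon(x)\cap R$, $W^u(x,R)=W^u_\varepsilon(x)\cap R$, where $\varepsilon$ is larger than $\mathrm{diam}(R)$. A Markov partition of $\Omega$ is a finite collection $\{R_1,\dots,R_m\}$ of proper rectangles with $\Omega=\bigcup_iR_i$; $\mathrm{int}(R_i)\cap\mathrm{int}(R_j)=\emptyset$ for $i\ne j$; and for $x\in\mathrm{int}(R_i)\cap f^{-1}(\mathrm{int}(R_j))$, $f(W^u(x,R_i))\supset W^u(f(x),R_j)$ and $f(W^s(x,R_i))\subset W^s(f(x),R_j)$. The transition matrix has $A_{ij}=1$ if $\mathrm{int}(R_i)\cap f^{-1}(\mathrm{int}(R_j))\ne\emptyset$ and $A_{ij}=0$ otherwise; $\Sigma_A=\{(a_i)_{i\in\mathbb{Z}}: A_{a_ia_{i+1}}=1\ \forall i\}$ with shift $(\sigma a)_i=a_{i+1}$. $h_{\mathrm{top}}$ is topological entropy. *)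

(* Defs.v *)
From HB Require Import structures.
From mathcomp Require Import all_boot all_order all_algebra.
From mathcomp Require Import all_classical all_reals all_analysis.
From mathcomp.real_closed Require Import complex.

Set Implicit Arguments.
Unset Strict Implicit.
Unset Printing Implicit Defensive.

Import Order.TTheory GRing.Theory Num.Theory.
Import numFieldNormedType.Exports.

Local Open Scope classical_set_scope.
Local Open Scope ring_scope.

(* [Cr_on r U f] is meant for open [U] and finite-dimensional [V]: for r = k.+1
   it asks for differentiability and for x |-> Df_x(v) to be C^k, for all v. *)
Fixpoint Cr_on (R : realType) (V W : normedModType R) (r : nat) (U : set V)
    (f : V -> W) : Prop :=
  match r with
  | 0 => forall x, U x -> {for x, continuous f}
  | k.+1 => (forall x, U x -> differentiable f x) /\
            (forall v : V, Cr_on k U (fun x => 'd f x v))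
  end.

Definition smooth_on (R : realType) (V W : normedModType R) (U : set V)
    (f : V -> W) : Prop := forall r, Cr_on r U f.

(* Charts are given by total functions [cmap i], [cinv i], which are meaningful
   only on [cdom i] and on its image. The function [chart_at] selects a chart
   around each point: a tangent vector at x is represented by its coordinates,
   of type 'rV[R]_n, in the chart [chart_at x]. *)
Record smooth_structure (R : realType) (n : nat) (M : topologicalType) :=
  SmoothStructure {
    cindex : Type;
    cdom : cindex -> set M;
    cmap : cindex -> M -> 'rV[R]_n;
    cinv : cindex -> 'rV[R]_n -> M;
    chart_at : M -> cindex;
    cdom_open : forall i, open (cdom i);
    cimage_open : forall i, open (cmap i @` cdom i);
    cmapK : forall i x, cdom i x -> cinv i (cmap i x) = x;
    cmap_continuous : forall i x, cdom i x -> {for x, continuous (cmap i)};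
    cinv_continuous : forall i y, (cmap i @` cdom i) y ->
      {for y, continuous (cinv i)};
    mem_chart_at : forall x, cdom (chart_at x) x;
    transition_smooth : forall i j,
      smooth_on (cmap i @` (cdom i `&` cdom j)) (cmap j \o cinv i)
  }.

Section Manifold.
Context {R : realType} {n : nat} {M : topologicalType}.
Variable S : smooth_structure R n M.
Local Notation E := 'rV[R]_n.

Definition coord_at (x : M) : E := cmap (chart_at S x) x.

(* The coordinates in chart i of the tangent vector v at x. *)
Definition tcoord (i : cindex S) (x : M) (v : E) : E :=
  'd (cmap i \o cinv (chart_at S x)) (coord_at x) v.

(* The tangent vector at x with coordinates v in chart i. *)
Definition of_tcoord (i : cindex S) (x : M) (v : E) : E :=
  'd (cmap (chart_at S x) \o cinv i) (cmap i x) v.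

Definition Cr_map (r : nat) (f : M -> M) : Prop :=
  continuous f /\
  forall i j : cindex S,
    Cr_on r (cmap i @` (cdom i `&` f @^-1` cdom j)) (cmap j \o f \o cinv i).

Definition Cr_diffeo (r : nat) (f finv : M -> M) : Prop :=
  [/\ cancel f finv, cancel finv f, Cr_map r f & Cr_map r finv].

Definition tmap (f : M -> M) (x : M) (v : E) : E :=
  'd (cmap (chart_at S (f x)) \o f \o cinv (chart_at S x)) (coord_at x) v.

Definition vfield_continuous_at (K : set M) (X : M -> E) (p : M) : Prop :=
  tcoord (chart_at S p) q (X q) @[q --> within K (nbhs p)]
    --> tcoord (chart_at S p) p (X p).

Definition continuous_subbundle (K : set M) (F : M -> {vspace E}) : Prop :=
  forall p, K p -> exists (k : nat) (X : 'I_k -> M -> E),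
    \forall q \near within K (nbhs p),
      basis_of (F q) [tuple X i q | i < k] /\
      forall i, vfield_continuous_at K (X i) q.

(* [gram x] is the Gram matrix of the inner product at x in the coordinates
   of the chart [chart_at x]. *)
Record riemannian_metric := RiemannianMetric {
  gram : M -> 'M[R]_n;
  gram_sym : forall x, (gram x)^T = gram x;
  gram_pos : forall x (v : E), v != 0 -> 0 < (v *m gram x *m v^T) 0 0;
  gram_smooth : forall (i : cindex S) (u v : E),
    smooth_on (cmap i @` cdom i)
      (fun y : E => let x := cinv i y in
        (of_tcoord i x u *m gram x *m (of_tcoord i x v)^T) 0 0)
}.

Variable g : riemannian_metric.

Definition tnorm (x : M) (v : E) : R := Num.sqrt ((v *m gram g x *m v^T) 0 0).

Definition velocity (gamma : R -> M) (t : R) : E :=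
  derive1 (cmap (chart_at S (gamma t)) \o gamma) t.

(* C^1 arcs parametrized by [0, 1], extended to a neighbourhood of [0, 1]. *)
Definition C1_arc (gamma : R -> M) : Prop :=
  forall t, t \in `[0, 1] ->
    let phi := cmap (chart_at S (gamma t)) \o gamma in
    [/\ {for t, continuous gamma},
        \forall s \near t, derivable phi s 1
      & {for t, continuous (derive1 phi)} ].

Definition arc_length (gamma : R -> M) : R :=
  Rintegral lebesgue_measure `[0, 1]
    (fun t => tnorm (gamma t) (velocity gamma t)).

(* [path_length x y l]: some piecewise C^1 curve from x to y has length l. *)
Inductive path_length : M -> M -> R -> Prop :=
| path_nil x : path_length x x 0
| path_cons gamma y l : C1_arc gamma -> path_length (gamma 1) y l ->
    path_length (gamma 0) y (arc_length gamma + l).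

Definition riemannian_dist (x y : M) : R := inf [set l | path_length x y l].

Definition hyperbolic (f finv : M -> M) (K : set M) : Prop :=
  [/\ compact K, f @` K = K &
    exists (Es Eu : M -> {vspace E}) (c lam : R),
    [/\ 0 < c, 0 < lam < 1,
        continuous_subbundle K Es /\ continuous_subbundle K Eu,
        forall x, K x ->
          [/\ (Es x + Eu x)%VS = fullv, (Es x :&: Eu x)%VS = 0%VS,
              tmap f x @` [set v | v \in Es x] = [set w | w \in Es (f x)]
            & tmap f x @` [set v | v \in Eu x] = [set w | w \in Eu (f x)] ]
      & forall x, K x -> forall (v : E) (k : nat),
          (v \in Es x ->
            tnorm (iter k f x) (tmap (iter k f) x v)
              <= c * lam ^+ k * tnorm x v) /\
          (v \in Eu x ->
            tnorm (iter k finv x) (tmap (iter k finv) x v)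
              <= c * lam ^+ k * tnorm x v) ] ].

Definition nonwandering (f : M -> M) : set M :=
  [set x | forall U, nbhs x U ->
    exists k, (0 < k)%N /\ (iter k f @` U) `&` U !=set0].

Definition periodic_points (f : M -> M) : set M :=
  [set x | exists k, (0 < k)%N /\ iter k f x = x].

Definition axiomA (f finv : M -> M) : Prop :=
  hyperbolic f finv (nonwandering f) /\
  nonwandering f `<=` closure (periodic_points f).

End Manifold.

(* On different components of M there is no Riemannian distance, and [mdist]
   is only required to be a metric compatible with the topology. *)
Definition mdist_is_riemannian (R : realType) (n : nat) (M : metricType R)
    (S : smooth_structure R n M) (g : riemannian_metric S) : Prop :=
  forall x y : M, (exists l, path_length g x y l) ->
    mdist x y = riemannian_dist g x y.

Section Dynamics.
Context {M : topologicalType}.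
Variable f : M -> M.

Definition transitive_on (K : set M) : Prop :=
  forall U V, open U -> open V -> K `&` U !=set0 -> K `&` V !=set0 ->
    exists k, (0 < k)%N /\ (iter k f @` (K `&` U)) `&` (K `&` V) !=set0.

Definition mixing_on (K : set M) : Prop :=
  forall U V, open U -> open V -> K `&` U !=set0 -> K `&` V !=set0 ->
    exists N, forall k, (N <= k)%N ->
      (iter k f @` (K `&` U)) `&` (K `&` V) !=set0.

Definition spectral_decomposition (k : nat) (B : 'I_k -> set M) : Prop :=
  [/\ nonwandering f = \bigcup_i B i,
      forall i j, i != j -> B i `&` B j = set0
    & forall i, [/\ B i !=set0, closed (B i), f @` B i = B i
                  & transitive_on (B i)] ].

Definition basic_set (K : set M) : Prop :=
  exists (k : nat) (B : 'I_k -> set M) (i : 'I_k),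
    spectral_decomposition B /\ K = B i.

End Dynamics.

Section Markov.
Context {R : realType} {M : metricType R}.
Variables (f finv : M -> M) (Om : set M) (eps delta0 : R).

Definition Ws (x : M) : set M :=
  [set y | forall k, mdist (iter k f x) (iter k f y) <= eps].

Definition Wu (x : M) : set M :=
  [set y | forall k, mdist (iter k finv x) (iter k finv y) <= eps].

(* z = [x, y] *)
Definition bracket (x y z : M) : Prop := Ws x `&` Wu y = [set z].

Definition has_brackets : Prop :=
  forall x y, Om x -> Om y -> mdist x y < delta0 ->
    exists2 z, Om z & bracket x y z.

Definition diam (A : set M) : R :=
  sup [set mdist p.1 p.2 | p in A `*` A].

(* Interior of A relative to Om. *)
Definition rint (A : set M) : set M :=
  [set x | Om x /\ within Om (nbhs x) A].

Definition rectangle (A : set M) : Prop :=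
  [/\ A `<=` Om, diam A < delta0
    & forall x y, A x -> A y -> exists2 z, A z & bracket x y z].

Definition proper_rectangle (A : set M) : Prop :=
  [/\ rectangle A, closed A & A = closure (rint A)].

Definition WsR (x : M) (A : set M) := Ws x `&` A.
Definition WuR (x : M) (A : set M) := Wu x `&` A.

Definition markov_partition (m : nat) (P : 'I_m -> set M) : Prop :=
  [/\ forall i, proper_rectangle (P i) /\ diam (P i) < eps,
      Om = \bigcup_i P i,
      forall i j, i != j -> rint (P i) `&` rint (P j) = set0
    & forall i j x, rint (P i) x -> rint (P j) (f x) ->
        WuR (f x) (P j) `<=` f @` WuR x (P i) /\
        f @` WsR x (P i) `<=` WsR (f x) (P j) ].

Definition transition_matrix (m : nat) (P : 'I_m -> set M) : 'M[R]_m :=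
  \matrix_(i, j) (`[< rint (P i) `&` f @^-1` rint (P j) !=set0 >])%:R.

End Markov.

Definition seq_space (m : nat) : topologicalType :=
  prod_topology (fun _ : int => discrete_topology 'I_m).

Definition seq_shift (m : nat) (a : seq_space m) : seq_space m :=
  fun i => a (i + 1).

Definition Sigma (R : realType) (m : nat) (A : 'M[R]_m) : set (seq_space m) :=
  [set a | forall i : int, A (a i) (a (i + 1)) = 1].

Section Entropy.
Context (R : realType) {X : topologicalType}.
Variables (T : X -> X) (K : set X).

Definition open_cover (U : set (set X)) : Prop :=
  (forall B, U B -> open B) /\ K `<=` \bigcup_(B in U) B.

Definition cover_join (U : set (set X)) (k : nat) : set (set X) :=
  [set B | exists2 u : nat -> set X, forall i, U (u i)
    & B = \bigcap_(i in `I_k) (iter i T @^-1` u i)].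

Definition cover_number (U : set (set X)) : R :=
  inf [set k%:R | k in [set k : nat | exists u : 'I_k -> set X,
    (forall i, U (u i)) /\ K `<=` \bigcup_i u i]].

(* For K compact and T-invariant the sequence converges, by subadditivity, so
   the limit superior is the usual limit. *)
Definition cover_entropy (U : set (set X)) : \bar R :=
  limn_esup (fun k : nat => (ln (cover_number (cover_join U k)) / k%:R)%:E).

(* Entropy of the restriction of T to the compact T-invariant set K, following
   Adler, Konheim and McAndrew: open covers of K are given by open sets of X. *)
Definition h_top : \bar R :=
  ereal_sup [set cover_entropy U | U in open_cover].

End Entropy.

Definition spectral_radius (R : realType) (m : nat) (A : 'M[R]_m) : R :=
  sup [set ComplexField.Normc.normc z | z in
    [set z : R[i] | eigenvalue (map_mx (real_complex R) A) z]].

(* Main.v *)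
Require Import Defs.
From HB Require Import structures.
From mathcomp Require Import all_boot all_order all_algebra.
From mathcomp Require Import all_classical all_reals all_analysis.
From mathcomp Require Import zify ring lra.
From mathcomp.real_closed Require Import complex.
Set Implicit Arguments.
Unset Strict Implicit.
Unset Printing Implicit Defensive.
Import Order.TTheory GRing.Theory Num.Theory.
Import numFieldNormedType.Exports.
Local Open Scope classical_set_scope.
Local Open Scope ring_scope.

(** Both entropies are computed as the exponential growth rate of the number of
admissible words, and that rate is the logarithm of the spectral radius.

The number N_k of admissible words with k transitions is the sum of the entries
of A^k. It is at least rho^k, since an eigenvector of a nonnegative matrix
cannot be stretched more than that sum ([eigenvalue_bound]), and at most
C mu^k for each mu > rho, by the Cayley-Hamilton theorem
([annihilated_powers_bound]).

A homeomorphism with a coding by admissible words has entropy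
lim (log N_k) / k ([coding_entropy]). For the upper bound, finite windows of
symbols generate: every open cover is refined by the cylinders of some fixed
length, so the k-th join of a cover has a subcover by N_(k+L) elements. For the
lower bound, there is a cover such that, inside one element of its k-th join,
at most one of the admissible words with given first and last letters can be
realized; hence every subcover has at least N_k / m^2 elements. This replaces
the usual argument that the semiconjugacy from the subshift is bounded-to-one.

For the subshift both properties are immediate ([symbolic_coding]). For the
basic set ([markov_coding]), the generating property is expansiveness, which is
the uniqueness of the bracket [x, x]; admissible words suffice to cover the set
because the points whose orbit stays in the interiors of the rectangles during
a given time are dense. The separation property ([itinerary_separated]) is a
diamond argument: if x and x' follow two words with the same ends and their
orbits stay close, then the bracket z of x and x' follows the word of x, being
on the stable set of x, and also the word of x', because its k-th image is the
bracket of the k-th images and lies on the unstable set of that of x'. Since z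
stays in the interiors of the rectangles, the two words agree. *)

(** * Growth of the powers of a nonnegative matrix *)

(** With C' >= C / (mu - l) the bound C' mu^k is stable under the recurrence. *)
Lemma geometric_recurrence (R : realFieldType) (l mu C : R) (y : nat -> R) :
  0 <= l < mu -> (forall k, y k.+1 <= l * y k + C * mu ^+ k) ->
  exists C', forall k, y k <= C' * mu ^+ k.
Proof.
move=> /andP[l0 lmu] yS; have mu0 : 0 < mu by exact: le_lt_trans lmu.
exists (Num.max (y 0%N) (C / (mu - l))); set C' := Num.max _ _.
have y0 : y 0%N <= C' by rewrite le_max lexx.
have CC' : C <= C' * (mu - l).
  by rewrite -ler_pdivrMr ?subr_gt0// le_max lexx orbT.
elim=> [|k IH]; first by rewrite expr0 mulr1.
apply: le_trans (yS k) _; rewrite exprS.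
apply: (@le_trans _ _ (l * (C' * mu ^+ k) + C' * (mu - l) * mu ^+ k)).
  by rewrite lerD// ?ler_wpM2l// ler_wpM2r// exprn_ge0// ltW.
by rewrite le_eqVlt; apply/orP; left; apply/eqP; ring.
Qed.

Local Notation normc := ComplexField.Normc.normc.

Lemma normc_ge0 (R : rcfType) (z : R[i]) : 0 <= normc z.
Proof. by case: z => a b; exact: sqrtr_ge0. Qed.

Lemma normc_sum (R : rcfType) (I : Type) (s : seq I) (F : I -> R[i]) :
  normc (\sum_(i <- s) F i) <= \sum_(i <- s) normc (F i).
Proof.
elim: s => [|i s IH]; first by rewrite !big_nil ComplexField.Normc.normc0.
by rewrite !big_cons (le_trans (le_normcD _ _))// lerD2l.
Qed.

(** The factors are removed one at a time: the entries of [B * A ^+ k] satisfy a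
first-order recurrence with ratio l whose inhomogeneous term is an entry of
[B * (A - l%:M) * A ^+ k], a matrix annihilated by the remaining factors. *)
Lemma annihilated_powers_bound (R : rcfType) m (A B : 'M[R[i]]_m.+1) (mu : R)
    (ls : seq R[i]) p q :
  0 < mu -> (forall l, l \in ls -> normc l < mu) ->
  B * \prod_(l <- ls) (A - l%:M) = 0 ->
  exists C, forall k, normc ((B * A ^+ k) p q) <= C * mu ^+ k.
Proof.
move=> mu0; elim: ls B => [|l ls IH] B lsmu.
  rewrite big_nil mulr1 => ->; exists 0 => k.
  by rewrite !mul0r mxE ComplexField.Normc.normc0.
rewrite big_cons mulrA => BA0.
have [C HC] : exists C, forall k,
    normc ((B * (A - l%:M) * A ^+ k) p q) <= C * mu ^+ k.
  by apply: IH BA0 => l' ls'; apply: lsmu; rewrite inE ls' orbT.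
apply: (@geometric_recurrence _ (normc l) mu C).
  by rewrite normc_ge0 lsmu// mem_head.
move=> k.
have -> : (B * A ^+ k.+1) p q
    = l * (B * A ^+ k) p q + (B * (A - l%:M) * A ^+ k) p q.
  have -> : B * A ^+ k.+1 = l *: (B * A ^+ k) + B * (A - l%:M) * A ^+ k.
    rewrite -mulrA mulrBl mulrBr exprS -!mulmxE mul_scalar_mx -scalemxAr.
    by rewrite addrC subrK.
  by rewrite [LHS]mxE [X in X + _]mxE.
apply: le_trans (le_normcD _ _) _.
by rewrite ComplexField.Normc.normcM lerD.
Qed.

Section SpectralRadius.
Context {R : realType} {m : nat}.
Variable A : 'M[R]_m.+1.

Local Notation AC := (map_mx (real_complex R) A).

Lemma normc_real (x : R) : normc (real_complex R x) = `|x|.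
Proof. by rewrite /= expr0n/= addr0 sqrtr_sqr. Qed.

(** In the equation v A^k = z^k v, look at the coordinate of v of largest
modulus. *)
Lemma eigenvalue_bound (z : R[i]) (k : nat) : (forall i j, 0 <= A i j) ->
  eigenvalue AC z -> normc z ^+ k <= \sum_i \sum_j (A ^+ k) i j.
Proof.
move=> A0 /eigenvalueP[v vA v0].
have Ak0 : forall k i j, 0 <= (A ^+ k) i j.
  elim=> [|l IH] i j; first by rewrite mxE; case: (i == j).
  by rewrite exprS mxE sumr_ge0// => h _; rewrite mulr_ge0.
have vAk : v *m (map_mx (real_complex R) (A ^+ k)) = z ^+ k *: v.
  elim: k => [|l IH]; first by rewrite !expr0 map_mx1 mulmx1 scale1r.
  by rewrite exprSr map_mxM mulmxA IH -scalemxAl vA scalerA -exprSr.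
pose j := [arg max_(j > (ord0 : 'I_m.+1)) normc (v 0 j)]%O.
have jmax i : normc (v 0 i) <= normc (v 0 j).
  by rewrite /j; case: arg_maxP => // j' _ /(_ i isT).
have vj0 : 0 < normc (v 0 j).
  rewrite lt_neqAle normc_ge0 andbT eq_sym; apply: contra v0 => /eqP vj.
  apply/eqP/rowP => i; rewrite mxE; apply: ComplexField.Normc.eq0_normc.
  by apply/eqP; rewrite eq_le normc_ge0 andbT -vj.
rewrite -(ler_pM2r vj0).
have -> : normc z ^+ k * normc (v 0 j) = normc ((z ^+ k *: v) 0 j).
  rewrite mxE ComplexField.Normc.normcM; congr (_ * _).
  by elim: (k) => [|l IH]; rewrite ?expr0 ?ComplexField.Normc.normc1// !exprS IH
    ComplexField.Normc.normcM.
rewrite -vAk mxE; apply: le_trans (normc_sum _ _) _.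
rewrite mulr_suml ler_sum// => i _.
rewrite ComplexField.Normc.normcM mxE normc_real ger0_norm// mulrC.
apply: ler_pM => //; first exact: normc_ge0.
by rewrite (bigD1 j)//= lerDl sumr_ge0.
Qed.

Lemma has_sup_spectrum :
  has_sup [set normc z | z in [set z | eigenvalue AC z]].
Proof.
have [rs rsE] := closed_field_poly_normal (char_poly AC).
have eigE z : eigenvalue AC z = (z \in rs).
  rewrite eigenvalue_root_char rsE (eqP (char_poly_monic _)) scale1r.
  exact: root_prod_XsubC.
split.
  case: rs rsE eigE => [|z rs] rsE eigE.
    have := size_char_poly AC.
    by rewrite rsE big_nil (eqP (char_poly_monic _)) scale1r size_poly1.
  by exists (normc z); exists z => //=; rewrite eigE mem_head.
exists (\sum_(z <- rs) normc z) => _ [z /= + <-]; rewrite eigE => zrs.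
by rewrite (big_rem z)//= lerDl sumr_ge0// => w _; exact: normc_ge0.
Qed.

(** By Cayley-Hamilton, the identity matrix is annihilated by the product of the
factors [A - z%:M] over the eigenvalues z. *)
Lemma powers_upper_bound (mu : R) : spectral_radius A < mu -> 0 < mu ->
  exists C, forall k, \sum_i \sum_j (A ^+ k) i j <= C * mu ^+ k.
Proof.
move=> rho_mu mu0.
have [rs rsE] := closed_field_poly_normal (char_poly AC).
have rsmu z : z \in rs -> normc z < mu.
  move=> zrs; apply: le_lt_trans rho_mu; apply: ub_le_sup.
    by case: has_sup_spectrum.
  exists z => //=; rewrite eigenvalue_root_char rsE (eqP (char_poly_monic _)).
  by rewrite scale1r root_prod_XsubC.
have HC p q : exists C, forall k, normc ((1 * AC ^+ k) p q) <= C * mu ^+ k.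
  apply: annihilated_powers_bound rsmu _ => //.
  rewrite mul1r -[RHS](Cayley_Hamilton AC) rsE (eqP (char_poly_monic _)).
  rewrite scale1r rmorph_prod; apply: eq_bigr => z _.
  by rewrite rmorphB /= horner_mx_X horner_mx_C.
pose C p := projT1 (choice (HC p)).
have boundC p : forall q k, normc ((1 * AC ^+ k) p q) <= C p q * mu ^+ k.
  exact: projT2 (choice (HC p)).
exists (\sum_i \sum_j C i j) => k.
rewrite mulr_suml ler_sum// => i _; rewrite mulr_suml ler_sum// => j _.
apply: le_trans (boundC i j k); rewrite mul1r -rmorphXn/= mxE normc_real.
exact: ler_norm.
Qed.

Lemma powers_lower_bound (mu : R) : (forall i j, 0 <= A i j) ->
  0 <= mu < spectral_radius A ->
  forall k, mu ^+ k <= \sum_i \sum_j (A ^+ k) i j.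
Proof.
move=> A0 /andP[mu0 /(sup_gt has_sup_spectrum.1) [_ [z zA <-] muz]] k.
apply: le_trans (eigenvalue_bound k A0 zA).
by rewrite lerXn2r ?nnegrE ?normc_ge0// ltW.
Qed.

End SpectralRadius.

(** * Admissible words *)

Section Walks.
Context {I : finType}.
Variable e : rel I.

(** The index [k] counts transitions: a word of [words k] has k + 1 letters. *)
Fixpoint walks (k : nat) (i : I) : seq (seq I) :=
  if k is k'.+1 then [seq i :: w | j <- enum (e i), w <- walks k' j]
  else [:: [:: i]].

Definition words (k : nat) : seq (seq I) :=
  [seq w | i <- enum I, w <- walks k i].

Lemma mem_walks k i w :
  (w \in walks k i) = [&& size w == k.+1, sorted e w & head i w == i].
Proof.
elim: k i w => [|k IH] i w.
  rewrite inE; case: w => [|j [|j' w]] //=; first by rewrite eqseq_cons andbT.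
  by rewrite !eqseq_cons andbF.
apply/allpairsPdep/idP => [[j [w' [+ + ->]]]|].
  rewrite mem_enum IH => eij /and3P[/eqP sw' ew' hw'] /=.
  rewrite sw' !eqxx andbT/=; case: w' sw' ew' hw' => //= j' w' _ ->.
  by rewrite andbT => /eqP ->.
case: w => [|i' [|j w]] //= /and3P[sw /andP[eij ew] /eqP ii'].
move: eij; rewrite ii' => eij.
by exists j, (j :: w); split; rewrite ?mem_enum// IH/= eqxx ew !andbT.
Qed.

Lemma mem_words k w : (w \in words k) = (size w == k.+1) && sorted e w.
Proof.
apply/allpairsPdep/andP => [[i [w' [_ + ->]]]|[sw ew]].
  by rewrite mem_walks => /and3P[-> ->].
case: w sw ew => // i w sw ew; exists i, (i :: w).
by rewrite mem_enum mem_walks sw ew/= eqxx.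
Qed.

Lemma uniq_walks k i : uniq (walks k i).
Proof.
elim: k i => [//|k IH] i /=; apply: allpairs_uniq_dep => //.
  exact: enum_uniq.
move=> [j w] [j' w'] /allpairsPdep[x [y [_ + [-> ->]]]].
rewrite mem_walks => /and3P[_ _ /eqP hy].
move=> /allpairsPdep[x' [y' [_ + [-> ->]]]].
rewrite mem_walks => /and3P[sy' _ /eqP hy'] /= [yy']; subst y'.
by rewrite -hy -hy'; case: y sy' {hy hy'}.
Qed.

Lemma uniq_words k : uniq (words k).
Proof.
apply: allpairs_uniq_dep => //; first exact: enum_uniq.
  by move=> ? _; exact: uniq_walks.
move=> [j w] [j' w'] /allpairsPdep[x [y [_ + [-> ->]]]].
rewrite mem_walks => /and3P[_ _ /eqP hy].
move=> /allpairsPdep[x' [y' [_ + [-> ->]]]].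
rewrite mem_walks => /and3P[sy' _ /eqP hy'] /= yy'; subst y'.
by rewrite -hy -hy'; case: y sy' {hy hy'}.
Qed.

End Walks.

Lemma size_words (R : nzRingType) m (e : rel 'I_m.+1) (A : 'M[R]_m.+1) k :
  (forall i j, A i j = (e i j)%:R) ->
  (size (words e k))%:R = \sum_i \sum_j (A ^+ k) i j.
Proof.
move=> Ae.
have walksE i : (size (walks e k i))%:R = \sum_j (A ^+ k) i j.
  elim: k i => [|k IH] i.
    rewrite (bigD1 i)//= mxE eqxx big1 ?addr0// => j ji.
    by rewrite mxE eq_sym (negPf ji).
  rewrite /= size_allpairs_dep sumnE big_map natr_sum big_enum/=.
  transitivity (\sum_j \sum_h A i j * (A ^+ k) j h).
    rewrite big_mkcond/=; apply: eq_bigr => j _.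
    by rewrite -mulr_sumr -IH Ae -topredE/=; case: (e i j); rewrite ?mul1r ?mul0r.
  rewrite exchange_big/=; apply: eq_bigr => h _.
  by rewrite exprS mxE.
rewrite size_allpairs_dep sumnE big_map natr_sum big_enum/=.
exact: eq_bigr.
Qed.

(** * Exponential growth rates *)

Lemma limn_esup_le (R : realType) (u : nat -> R) (l : R) :
  (forall d, 0 < d -> \forall k \near \oo, u k <= l + d) ->
  (limn_esup (fun k => (u k)%:E) <= l%:E)%E.
Proof.
move=> ul; apply/lee_addgt0Pr => d d0; have [N _ HN] := ul d d0.
apply: ge_ereal_inf; exists (ereal_sup [set (u k)%:E | k in [set k | (N <= k)%N]]).
  by exists [set k | (N <= k)%N] => //; exists N.
by apply: ge_ereal_sup => _ [k Nk <-]; rewrite -EFinD lee_fin; exact: HN.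
Qed.

Lemma limn_esup_ge (R : realType) (u : nat -> R) (l : R) :
  (forall d, 0 < d -> \forall k \near \oo, l - d <= u k) ->
  (l%:E <= limn_esup (fun k => (u k)%:E))%E.
Proof.
move=> ul; apply: le_ereal_inf_tmp => _ [V Voo <-].
apply/lee_subgt0Pr => d d0.
have [k [Vk uk]] : exists k, V k /\ l - d <= u k.
  have [N _ HN] := filterI Voo (ul d d0).
  by exists N; have := HN N (leqnn N).
apply: le_ereal_sup_tmp; exists (u k)%:E; first by exists k.
by rewrite -EFinB lee_fin.
Qed.

Lemma near_div_nat_le (R : realType) (D d : R) : 0 < d ->
  \forall k \near \oo, (0 < k)%N /\ D / k%:R <= d.
Proof.
move=> d0; exists (Num.truncn (D / d)).+1 => // k /= Nk.
have k0 : (0 < k)%N by exact: leq_ltn_trans Nk.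
split=> //; rewrite ler_pdivrMr ?ltr0n// mulrC -ler_pdivrMr// ltW//.
by rewrite (lt_le_trans (truncnS_gt _))// ler_nat.
Qed.

Lemma limn_esup_ln_le (R : realType) (a : nat -> R) (C mu : R) : 1 < mu ->
  (forall k, a k <= C * mu ^+ k) ->
  (limn_esup (fun k => (ln (a k) / k%:R)%:E) <= (ln mu)%:E)%E.
Proof.
move=> mu1 aC; apply: limn_esup_le => d d0.
have mu0 : 0 < mu by exact: lt_trans mu1.
pose C' := Num.max C 1.
have C0 : 0 < C' by rewrite lt_max ltr01 orbT.
apply: filterS (near_div_nat_le (ln C') d0) => k [k0 Ck].
have lnC' : 0 <= ln C' by rewrite ln_ge0// le_max lexx orbT.
have : ln (a k) <= ln C' + ln mu * k%:R.
  have [ak0|ak0] := leP (a k) 0.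
    by rewrite ln0// addr_ge0// mulr_ge0// ln_ge0// ltW.
  have -> : ln C' + ln mu * k%:R = ln (C' * mu ^+ k).
    by rewrite lnM ?posrE ?exprn_gt0// lnXn// mulr_natr.
  rewrite ler_ln ?posrE ?mulr_gt0 ?exprn_gt0//.
  apply: le_trans (aC k) _; apply: ler_wpM2r; first by rewrite exprn_ge0// ltW.
  by rewrite le_max lexx.
move=> lnak; rewrite addrC; apply: le_trans (_ : ln C' / k%:R + ln mu <= _).
  by rewrite ler_pdivrMr ?ltr0n// mulrDl divfK// pnatr_eq0 -lt0n.
by rewrite lerD2r.
Qed.

Lemma limn_esup_ln_ge (R : realType) (a : nat -> R) (c mu : R) : 0 < mu -> 0 < c ->
  (forall k, (0 < k)%N -> c * mu ^+ k <= a k.+1) ->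
  ((ln mu)%:E <= limn_esup (fun k => (ln (a k) / k%:R)%:E))%E.
Proof.
move=> mu0 c0 aC; apply: limn_esup_ge => d d0.
apply: filterS (filterI (near_div_nat_le (- ln (c / mu)) d0)
  (nbhs_infty_ge 2)) => -[[[]//]|k [[_ Ck] k0]].
have k10 : 0 < k.+1%:R :> R by rewrite ltr0n.
rewrite ler_pdivlMr//; apply: (@le_trans _ _ (ln (c * mu ^+ k))); last first.
  by rewrite ler_ln ?posrE ?mulr_gt0 ?exprn_gt0 ?aC// (lt_le_trans _ (aC k k0))//
    mulr_gt0 ?exprn_gt0.
move: Ck; rewrite ler_pdivrMr// => Ck.
have -> : c * mu ^+ k = c / mu * mu ^+ k.+1.
  by rewrite exprS mulrA divfK// gt_eqF.
rewrite lnM ?posrE ?divr_gt0 ?exprn_gt0// lnXn// -(mulr_natr (ln mu)).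
by rewrite mulrBl; lra.
Qed.

(** * Entropy of a coded system *)

Section Coding.
Context (R : realType) {X : topologicalType} {I : finType}.
Variables (T : X -> X) (K : set X) (e : rel I) (i0 : I) (Q Q' : I -> set X).

Definition follows (D : I -> set X) (k : nat) (w : seq I) (x : X) : Prop :=
  forall j, (j <= k)%N -> D (nth i0 w j) (iter j T x).

Definition same_code (k : nat) (x y : X) : Prop :=
  forall j, (j <= k)%N -> exists i, Q i (iter j T x) /\ Q i (iter j T y).

(** The system is coded by the sets [Q i], meant to be closed, and by smaller
sets [Q' i], meant to be their interiors. Points of [K] follow an admissible
word with respect to [Q], possibly several; realizing every admissible word and
separating different ones is asked with respect to [Q']. In
[coding_generates] the window of the code starts at time 0 and the conclusion is
shifted to the time [s] inside the window, so that a two-sided generator is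
expressed without the inverse of [T]. Words without transitions are excluded
from [coding_realized] because a letter may have an empty set [Q' i]. *)
Record coding : Prop := Coding {
  coding_nonempty : K !=set0;
  coding_image : T @` K = K;
  coding_cover : forall k x, K x -> exists2 w, w \in words e k & follows Q k w x;
  coding_generates : forall U, open_cover K U -> exists s L, forall x, K x ->
    exists2 B, U B & forall y, K y -> same_code L x y -> B (iter s T y);
  coding_realized : forall k w, (0 < k)%N -> w \in words e k ->
    exists2 x, K x & follows Q' k w x;
  coding_separates : exists2 V, open_cover K V &
    forall k w w' x x', w \in words e k -> w' \in words e k -> K x -> K x' ->
      follows Q' k w x -> follows Q' k w' x' ->
      nth i0 w 0 = nth i0 w' 0 -> nth i0 w k = nth i0 w' k ->
      (forall j, (j <= k)%N -> exists2 B, V B & B (iter j T x) /\ B (iter j T x'))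
      -> w = w'
}.

Hypothesis code : coding.

Let K_iter k x : K x -> K (iter k T x).
Proof.
by move=> Kx; elim: k => //= k IH; rewrite -(coding_image code); exists (iter k T x).
Qed.

Let K_iter_surj k x : K x -> exists2 y, K y & iter k T y = x.
Proof.
elim: k x => [|k IH] x; first by exists x.
by rewrite -{1}(coding_image code) => -[y /IH[z Kz <-] <-]; exists z.
Qed.

(** All points that follow a given word of k + L transitions have, at each time
j < k, the same code over the window of length L starting at j. By
[coding_generates] their s-th images thus lie in a common element of the join;
as T maps K onto K, these images cover K. *)
Lemma join_subcover U : open_cover K U -> exists L, forall k,
  exists u : 'I_(size (words e (k + L))) -> set X,
    (forall i, cover_join T U k (u i)) /\ K `<=` \bigcup_i u i.
Proof.
move=> UK; have [s [L gen]] := coding_generates code UK; exists L => k.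
have [x0 Kx0] := coding_nonempty code.
have [u0 Uu0] : exists B, U B by have [B UB _] := gen x0 Kx0; exists B.
have cyl w : exists B, cover_join T U k B /\
    forall y, K y -> follows Q (k + L) w y -> B (iter s T y).
  have [[x Kx wx]|nx] := pselect (exists2 x, K x & follows Q (k + L) w x).
    have /choice[B HB] j : exists B, U B /\
        forall y, K y -> same_code L (iter j T x) y -> B (iter s T y).
      by have [B UB HB] := gen _ (K_iter j Kx); exists B.
    exists (\bigcap_(j in `I_k) (iter j T @^-1` B j)); split.
      by exists B => // j; have [] := HB j.
    move=> y Ky wy j /= jk; rewrite -iterD addnC iterD.
    have [_] := HB j; apply; first exact: K_iter.
    move=> h hL; exists (nth i0 w (h + j)); rewrite -!iterD.
    have hj : (h + j <= k + L)%N by rewrite addnC leq_add// ltnW.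
    by split; [exact: wx|exact: wy].
  exists (\bigcap_(j in `I_k) (iter j T @^-1` u0)); split.
    by exists (fun=> u0).
  by move=> y Ky wy; case: nx; exists y.
have [B HB] := choice cyl.
exists (fun i => B (nth [::] (words e (k + L)) i)); split.
  by move=> i; have [] := HB (nth [::] (words e (k + L)) i).
move=> y /(K_iter_surj s)[x Kx <-].
have [w /(nthP [::])[i iw <-] wx] := coding_cover code (k + L) Kx.
exists (Ordinal iw) => //=.
by have [_] := HB (nth [::] (words e (k + L)) i); apply.
Qed.

Lemma cover_number_le U : open_cover K U -> exists L, forall k,
  cover_number R K (cover_join T U k) <= (size (words e (k + L)))%:R.
Proof.
move=> /join_subcover[L HL]; exists L => k; apply: ge_inf.
  by exists 0 => _ [c _ <-].
by exists (size (words e (k + L))).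
Qed.

(** Two realized words in one element of the join have points in common elements
of V at all times 0, ..., k; so a word is determined by the element of the
subcover together with its first and last letters. *)
Lemma cover_number_ge : exists2 V, open_cover K V & forall k, (0 < k)%N ->
  (size (words e k))%:R <=
    (#|I| * #|I|)%:R * cover_number R K (cover_join T V k.+1) :> R.
Proof.
have [V VK sep] := coding_separates code; exists V => // k k0.
have I0 : 0 < (#|I| * #|I|)%:R :> R.
  by rewrite ltr0n muln_gt0 andbb; apply/card_gt0P; exists i0.
rewrite mulrC -ler_pdivrMr//; apply: lb_le_inf.
  have [L HL] := join_subcover VK.
  by exists (size (words e (k.+1 + L)))%:R; exists (size (words e (k.+1 + L))).
move=> _ [c [u [uV Ku]] <-]; rewrite ler_pdivrMr// -natrM ler_nat.
have /choice[pt ptP] w : exists p : X * 'I_c, w \in words e k ->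
    [/\ K p.1, follows Q' k w p.1 & u p.2 p.1].
  have [wk|_] := boolP (w \in words e k); last first.
    have [x0 Kx0] := coding_nonempty code; have [i _ _] := Ku x0 Kx0.
    by exists (x0, i).
  have [x Kx wx] := coding_realized code k0 wk; have [i _ ui] := Ku x Kx.
  by exists (x, i).
pose phi w := ((pt w).2, (nth i0 w 0, nth i0 w k)).
have phi_inj : {in words e k &, injective phi}.
  move=> w w' wk wk' [eqi eq0 eqk].
  have [Kx wx ux] := ptP w wk; have [Kx' wx' ux'] := ptP w' wk'.
  apply: (sep k w w' (pt w).1 (pt w').1) => // j jk.
  have [b bV uE] := uV (pt w).2; exists (b j) => //.
  by move: ux ux'; rewrite -eqi uE => /(_ j jk) ? /(_ j jk).
have := max_card (mem (map phi (words e k))).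
rewrite (card_uniqP _); last by rewrite map_inj_in_uniq// uniq_words.
by rewrite size_map !card_prod card_ord.
Qed.

(** The hypotheses say that the number of words has exponential growth rate
[ln rho]; as there is at least one word of each length, [rho] is at least 1. *)
Theorem coding_entropy (rho : R) :
  (forall mu, 0 < mu -> rho < mu -> exists C, forall k,
    (size (words e k))%:R <= C * mu ^+ k) ->
  (forall mu, 0 <= mu < rho -> forall k, mu ^+ k <= (size (words e k))%:R) ->
  h_top R T K = (ln rho)%:E.
Proof.
move=> up low.
have words_ge1 k : 1 <= (size (words e k))%:R :> R.
  have [x0 Kx0] := coding_nonempty code.
  have [w wk _] := coding_cover code k Kx0.
  by rewrite (ler_nat _ 1); case: (words e k) wk.
have rho1 : 1 <= rho.
  rewrite leNgt; apply/negP => rho1.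
  pose mu := (Num.max rho 0 + 1) / 2.
  have [mu0 mu1 rhomu] : [/\ 0 < mu, mu < 1 & rho < mu].
    by rewrite /mu; case: (leP rho 0) => ?; split; lra.
  have [C HC] := up mu mu0 rhomu.
  have /cvgrPdist_lt/(_ 1 ltr01)[N _ /(_ N (leqnn N))] :
      C * mu ^+ k @[k --> \oo] --> 0.
    rewrite -[X in _ --> X](mulr0 C); apply: cvgMr; apply: cvg_expr.
    by rewrite gtr0_norm.
  by rewrite /= sub0r normrN ltNge (le_trans _ (ler_norm _))// (le_trans _ (HC N)).
have rho0 : 0 < rho by exact: lt_le_trans rho1.
apply/eqP; rewrite eq_le; apply/andP; split.
  apply: ge_ereal_sup => _ [U UK <-]; apply/lee_addgt0Pr => d d0.
  pose mu := rho * expR d.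
  have rhomu : rho < mu by rewrite ltr_pMr// expR_gt1.
  have mu0 : 0 < mu by exact: lt_trans rhomu.
  have [C HC] := up mu mu0 rhomu; have [L HL] := cover_number_le UK.
  rewrite -EFinD -[X in ln rho + X]expRK -lnM ?posrE ?expR_gt0// -/mu.
  apply: (@limn_esup_ln_le _ _ (C * mu ^+ L)); first exact: le_lt_trans rhomu.
  by move=> k; rewrite (le_trans (HL k))// (le_trans (HC _))// addnC exprD mulrA.
have [V VK HV] := cover_number_ge.
apply: le_ereal_sup_tmp; exists (cover_entropy R T K V); first by exists V.
apply/lee_subgt0Pr => d d0; pose mu := rho * expR (- d).
have mu0 : 0 < mu by rewrite mulr_gt0// expR_gt0.
have murho : mu < rho by rewrite gtr_pMr// expR_lt1 oppr_lt0.
have I0 : 0 < (#|I| * #|I|)%:R :> R.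
  by rewrite ltr0n muln_gt0 andbb; apply/card_gt0P; exists i0.
rewrite -EFinB -[X in ln rho + X]expRK -lnM ?posrE ?expR_gt0// -/mu.
apply: (@limn_esup_ln_ge _ _ ((#|I| * #|I|)%:R)^-1) => //; first by rewrite invr_gt0.
move=> k k0; rewrite ler_pdivrMl// (le_trans _ (HV k k0))// low//.
by rewrite ltW.
Qed.

End Coding.

(** [E L x y] stands for: x and y are not distinguished up to time L. Compactness
is used twice. Given x in an element B of the cover, the points outside B form a
compact set, so one N distinguishes all of them from the points near x; then N
is made uniform in x. *)
Lemma generator_of_separation (X : topologicalType) (K : set X)
    (E : nat -> X -> X -> Prop) :
  compact K ->
  (forall x y, K x -> K y -> x <> y -> exists N,
    \forall x' \near x & y' \near y, forall L, (N <= L)%N -> ~ E L x' y') ->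
  forall U, open_cover K U -> exists L, forall x, K x ->
    exists2 B, U B & forall y, K y -> E L x y -> B y.
Proof.
move=> Kcpt sep U [Uo KU].
suff [L _ HL] : \forall L \near \oo, K `<=`
    [set x | exists2 B, U B & forall y, K y -> E L x y -> B y].
  by exists L; exact: (HL L (leqnn L)).
move/compact_near_coveringP: (Kcpt); apply => x Kx.
have [B UB Bx] := KU x Kx.
have /compact_near_coveringP cov : compact (K `\` B).
  by rewrite setDE; apply: compact_closedI => //; rewrite closedC; exact: Uo.
have := cov (X * nat)%type (filter_prod (nbhs x) \oo)
  (fun p y => ~ E p.2 p.1 y) _ _.
case=> [y [Ky By]|[V1 V2] [V1x V2oo] V12].
  have xy : x <> y by move=> xy; apply: By; rewrite -xy.
  have [N [[V W] [/= Vx Wy] VW]] := sep x y Kx Ky xy.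
  exists (W, V `*` [set L | (N <= L)%N]) => /=.
    split=> //=; exists (V, [set L | (N <= L)%N]) => //=; split=> //.
    by exists N.
  by move=> [y' [x' L]] /= [Wy' [Vx' NL]]; apply: (VW (x', y')).
exists (V1, V2) => // -[x' L] /= VxL; exists B => // y Ky Exy.
by apply: contrapT => nBy; exact: (V12 (x', L) VxL y (conj Ky nBy)).
Qed.

(** * Subshifts of finite type *)

Lemma iter_seq_shift m k (a : seq_space m) (z : int) :
  iter k (@seq_shift m) a z = a (z + k%:Z).
Proof.
elim: k z => [|k IH] z; first by rewrite addr0.
by rewrite /= {1}/seq_shift IH; congr (a _); lia.
Qed.

Section SymbolicCoding.
Context {m : nat}.
Variables (e : rel 'I_m) (i0 : 'I_m).
Hypothesis e_ext : forall i j, e i j -> (exists h, e h i) /\ (exists h, e j h).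
Hypothesis e_nonempty : exists i j, e i j.

Let Sig : set (seq_space m) := [set a | forall z : int, e (a z) (a (z + 1))].
Let Cyl (i : 'I_m) : set (seq_space m) := [set a | a 0 = i].

Lemma open_coordinate (z : int) (i : 'I_m) : open [set a : seq_space m | a z = i].
Proof.
have c := @proj_continuous int (fun=> discrete_topology 'I_m) z.
pose p (a : seq_space m) : discrete_topology 'I_m := a z.
have pc : continuous p by exact: c.
have := iffLR (@continuousP (seq_space m) _ p) pc [set i].
by apply; exact: discrete_open.
Qed.

Lemma near_coordinate (a : seq_space m) (z : int) : \forall b \near a, b z = a z.
Proof. exact: open_nbhs_nbhs (conj (open_coordinate z (a z)) erefl). Qed.

Lemma compact_Sig : compact Sig.
Proof.
have cT : compact [set: seq_space m].
  have cI : compact [set: discrete_topology 'I_m].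
    by apply: finite_compact; exact: (@finite_finset 'I_m).
  have := @tychonoff int (fun=> discrete_topology 'I_m) (fun=> setT) (fun=> cI).
  by congr (compact _); apply/seteqP; split.
apply: (subclosed_compact _ cT) => // a cla z.
have [b [Sb [ba ba1]]] :=
  cla _ (filterI (near_coordinate a z) (near_coordinate a (z + 1))).
by rewrite -ba -ba1; exact: Sb.
Qed.

(** The hypothesis [e_ext] propagates along transitions, so a word with at least
one transition is continued in both directions by iterating choices of a
successor and of a predecessor. *)
Lemma extend_word k w : (0 < k)%N -> w \in words e k ->
  exists2 a, Sig a & forall j, (j <= k)%N -> a j%:Z = nth i0 w j.
Proof.
move=> k0; rewrite mem_words => /andP[/eqP sw /(sortedP i0) ew].
have /choice[nxt Hnxt] j : exists h, (exists h, e j h) -> e j h.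
  by have [[h jh]|nj] := pselect (exists h, e j h); [exists h|exists i0].
have /choice[prv Hprv] j : exists h, (exists h, e h j) -> e h j.
  by have [[h jh]|nj] := pselect (exists h, e h j); [exists h|exists i0].
pose fwd n := if (n <= k)%N then nth i0 w n else iter (n - k) nxt (nth i0 w k).
pose bwd n := iter n prv (nth i0 w 0).
have fwdP n : e (fwd n) (fwd n.+1).
  elim: n => [|n IH]; first by rewrite /fwd/= k0; apply: ew; rewrite sw.
  have {IH}live := Hnxt _ (e_ext IH).2.
  have [nk|kn] := ltnP n.+1 k.
    by rewrite /fwd nk (ltnW nk); apply: ew; rewrite sw.
  suff -> : fwd n.+2 = nxt (fwd n.+1) by [].
  rewrite /fwd ltnNge kn/= subSn// iterS; congr nxt; case: leqP => // nk.
  by rewrite (_ : n.+1 = k) ?subnn//; apply/eqP; rewrite eqn_leq nk.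
have bwdP n : e (bwd n.+1) (bwd n).
  elim: n => [|n IH]; last exact: Hprv (e_ext IH).1.
  have e01 := fwdP 0%N; rewrite /fwd/= k0 in e01.
  exact: Hprv (e_ext e01).1.
exists (fun z : int => match z with Posz n => fwd n | Negz n => bwd n.+1 end).
  move=> [n|[|n]].
  - by rewrite -PoszD addn1; exact: fwdP.
  - rewrite (_ : Negz 0 + 1 = Posz 0)//= [X in e _ X](_ : _ = bwd 0%N).
      exact: (bwdP 0%N).
    by rewrite /fwd leq0n.
  - have -> : Negz n.+1 + 1 = Negz n by lia.
    exact: (bwdP n.+1).
by move=> j jk; rewrite /fwd jk.
Qed.

(** The code of a sequence is the sequence itself: it generates because the
topology is generated by cylinders, and the cover by one-letter cylinders
separates all words. *)
Lemma symbolic_coding : coding (@seq_shift m) Sig e i0 Cyl Cyl.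
Proof.
have cylE k (w : seq 'I_m) (a : seq_space m) :
    follows (@seq_shift m) i0 Cyl k w a <-> (forall j, (j <= k)%N -> a j%:Z = nth i0 w j).
  by split=> H j /H; rewrite /Cyl/= iter_seq_shift add0r.
split.
- have [i [j ij]] := e_nonempty.
  have [|a Sa _] := @extend_word 1 [:: i; j] isT; last by exists a.
  by rewrite mem_words /= ij.
- apply/seteqP; split=> [_ [a Sa <-] z|a Sa]; first exact: Sa.
  exists (fun z => a (z - 1)); last by apply/funext => z; rewrite /seq_shift addrK.
  by move=> z; rewrite addrAC; exact: Sa.
- move=> k a Sa; exists (mkseq (fun j => a j%:Z) k.+1).
    rewrite mem_words size_mkseq eqxx.
    apply/(sortedP i0) => j; rewrite size_mkseq => jk.
    by rewrite !nth_mkseq ?(ltnW jk)// -addn1 PoszD; exact: Sa.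
  by apply/cylE => j jk; rewrite nth_mkseq.
- move=> U UK.
  pose E L (a b : seq_space m) := forall z : int, (`|z| <= L)%N -> a z = b z.
  have [|L HL] := @generator_of_separation _ _ E compact_Sig _ U UK.
    move=> a b _ _ ab; have /existsNP[z az] : ~ forall z, a z = b z.
      by move=> H; apply: ab; apply/funext.
    exists `|z|%N; exists ([set a' | a' z = a z], [set b' | b' z = b z]) => /=.
      by split; exact: near_coordinate.
    by move=> [a' b'] /= [az' bz'] L zL /(_ z zL); rewrite az' bz'.
  exists L, (L + L)%N => a Sa.
  have Siter b : Sig b -> Sig (iter L (@seq_shift m) b).
    by move=> Sb z; rewrite !iter_seq_shift addrAC; exact: Sb.
  have [B UB HB] := HL _ (Siter a Sa); exists B => // b Sb ab.
  apply: HB; first exact: Siter.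
  move=> z zL; rewrite !iter_seq_shift.
  have [n nL ->] : exists2 n, (n <= L + L)%N & z + L%:Z = n%:Z.
    by exists (absz (z + L%:Z)); lia.
  by have [i []] := ab n nL; rewrite /Cyl/= !iter_seq_shift !add0r => -> ->.
- move=> k w k0 wk; have [a Sa aw] := extend_word k0 wk.
  by exists a => //; exact/cylE.
- exists (range Cyl).
    split; first by move=> _ [i _ <-]; exact: open_coordinate.
    by move=> a Sa; exists (Cyl (a 0)) => //; exists (a 0).
  move=> k w w' a a' wk wk' _ _ /cylE aw /cylE aw' _ _ V.
  move: wk wk'; rewrite !mem_words => /andP[/eqP sw _] /andP[/eqP sw' _].
  apply: (@eq_from_nth _ i0); first by rewrite sw sw'.
  move=> j; rewrite sw => jk; have [_ [i _ <-]] := V j jk.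
  by rewrite /Cyl/= !iter_seq_shift !add0r -aw// -aw'// => -[-> ->].
Qed.

End SymbolicCoding.

(** * Brackets, expansiveness and rectangles *)

Section MetricFacts.
Context {R : realType} {M : metricType R}.
Implicit Types (x y z : M) (h : M -> M).

Lemma near_mdist_lt x (d : R) : 0 < d -> \forall y \near x, mdist x y < d.
Proof. by move=> d0; have := @nbhsx_ballx _ _ x d d0; rewrite ballEmdist. Qed.

Lemma iter_continuous h k : continuous h -> continuous (iter k h).
Proof.
move=> hc; elim: k => [|k IH] x; first exact: cvg_id.
exact: (@continuous_comp _ _ _ (iter k h) h x (IH x) (hc _)).
Qed.

Lemma near_mdist_gt h x y (d : R) : continuous h -> d < mdist (h x) (h y) ->
  \forall x' \near x & y' \near y, d < mdist (h x') (h y').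
Proof.
move=> hc dxy; pose a := (mdist (h x) (h y) - d) / 2.
have a0 : 0 < a by rewrite divr_gt0// subr_gt0.
have nx := hc x _ (near_mdist_lt (h x) a0).
have ny := hc y _ (near_mdist_lt (h y) a0).
exists ([set x' | mdist (h x) (h x') < a], [set y' | mdist (h y) (h y') < a]) => //.
move=> [x' y'] /= [xx' yy'].
have := metric_triangle (h x) (h x') (h y).
have := metric_triangle (h x') (h y') (h y).
by rewrite (metric_sym (h y')); move: xx' yy'; rewrite /a; lra.
Qed.

Hypothesis M_compact : compact [set: M].

Lemma mdist_le_diam (A : set M) x y : A x -> A y -> mdist x y <= diam A.
Proof.
move=> Ax Ay; apply: ub_le_sup; last by exists (x, y).
have [N _ HN] : \forall N \near \oo, [set: M] `<=` [set y | mdist x y <= N%:R].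
  move/compact_near_coveringP: M_compact; apply => z _.
  exists ([set z' | mdist z z' < 1], [set N | (Num.truncn (mdist x z + 1)).+1 <= N]%N).
    split=> /=; first exact: near_mdist_lt.
    exact: nbhs_infty_ge.
  move=> [z' N] /= [zz' zN]; apply: le_trans (metric_triangle _ z _) _.
  apply: (@le_trans _ _ (mdist x z + 1)); first by rewrite lerD2l ltW.
  by rewrite (le_trans (ltW (truncnS_gt _)))// ler_nat.
exists (N%:R + N%:R) => _ [[u v] _ <-] /=.
have xu := HN N (leqnn N) u I; have xv := HN N (leqnn N) v I.
by rewrite (le_trans (metric_triangle u x v))// metric_sym lerD.
Qed.

End MetricFacts.

Arguments iter_continuous {R M h} k _ _.

Section MarkovPartition.
Context {R : realType} {M : metricType R}.
Variables (f finv : M -> M) (Om : set M) (eps delta0 : R).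
Hypotheses (M_compact : compact [set: M]).
Hypotheses (fK : cancel f finv) (finvK : cancel finv f).
Hypotheses (f_cont : continuous f) (finv_cont : continuous finv).
Hypotheses (Om_neq0 : Om !=set0) (Om_closed : closed Om) (f_Om : f @` Om = Om).
Hypotheses (eps_gt0 : 0 < eps) (delta0_gt0 : 0 < delta0).
Hypothesis Om_brackets : has_brackets f finv Om eps delta0.

Local Notation Ws := (Ws f eps).
Local Notation Wu := (Wu finv eps).
Local Notation bracket := (bracket f finv eps).
Local Notation rint := (rint Om).

Lemma Om_f x : Om x -> Om (f x).
Proof. by move=> Omx; rewrite -f_Om; exists x. Qed.

Lemma Om_finv x : Om x -> Om (finv x).
Proof. by rewrite -{1}f_Om => -[y Omy <-]; rewrite fK. Qed.

Lemma Om_iter k x : Om x -> Om (iter k f x).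
Proof. by move=> Omx; elim: k => //= k; exact: Om_f. Qed.

Lemma Om_iter_finv k x : Om x -> Om (iter k finv x).
Proof. by move=> Omx; elim: k => //= k; exact: Om_finv. Qed.

Lemma iter_finvK k : cancel (iter k finv) (iter k f).
Proof. by elim: k => // k IH x; rewrite iterSr /= finvK IH. Qed.

Lemma iter_fK k : cancel (iter k f) (iter k finv).
Proof. by elim: k => // k IH x; rewrite iterSr /= fK IH. Qed.

Lemma Ws_sym x y : Ws x y -> Ws y x.
Proof. by move=> H k; rewrite metric_sym. Qed.

Lemma Wu_sym x y : Wu x y -> Wu y x.
Proof. by move=> H k; rewrite metric_sym. Qed.

Lemma Ws_refl x : Ws x x.
Proof. by move=> k; rewrite mdistxx ltW. Qed.

Lemma Wu_refl x : Wu x x.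
Proof. by move=> k; rewrite mdistxx ltW. Qed.

Lemma Ws_iter k x y : Ws x y -> Ws (iter k f x) (iter k f y).
Proof. by move=> H j; rewrite -!iterD. Qed.

Lemma Wu_iter k x y : Wu x y -> Wu (iter k finv x) (iter k finv y).
Proof. by move=> H j; rewrite -!iterD. Qed.

Lemma bracket_unique x y z w : bracket x y z -> Ws x w -> Wu y w -> w = z.
Proof. by move=> xyz xw yw; have : (Ws x `&` Wu y) w by []; rewrite xyz. Qed.

Lemma bracket_in x y z : bracket x y z -> Ws x z /\ Wu y z.
Proof. by move=> xyz; have : [set z] z by []; rewrite -xyz. Qed.

(** Both x and y are points of the bracket of x with itself. *)
Lemma expansive x y : Om x -> Ws x y -> Wu x y -> x = y.
Proof.
move=> Omx xy1 xy2; have [z _ xxz] : exists2 z, Om z & bracket x x z.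
  by apply: Om_brackets => //; rewrite mdistxx.
rewrite (bracket_unique xxz xy1 xy2).
exact: bracket_unique xxz (Ws_refl x) (Wu_refl x).
Qed.

(** The complement of the interior of O is compact and contains no point of both
Ws x and Wu y. At each of its points this is witnessed by one iterate, hence
persists for nearby points and for p and q close to x and y. *)
Lemma bracket_continuous x y z (O : set M) : bracket x y z -> nbhs z O ->
  \forall p \near x & q \near y, forall u, Ws p u -> Wu q u -> O u.
Proof.
move=> xyz Oz; have cptO : compact (~` O°).
  by rewrite -[X in compact X]setTI; apply: compact_closedI => //;
    rewrite closedC; exact: open_interior.
have [V nV HV] : \forall pq \near filter_prod (nbhs x) (nbhs y),
    ~` O° `<=` [set u | ~ (Ws pq.1 u /\ Wu pq.2 u)].
  move/compact_near_coveringP : cptO; apply => u /= nOu.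
  have uz : u <> z by move=> uz; apply: nOu; rewrite uz.
  have : ~ (Ws x u /\ Wu y u).
    by move=> [xu yu]; apply: uz; exact: bracket_unique xyz xu yu.
  move=> /not_andP[] /existsNP[k /negP]; rewrite -ltNge => ek.
    have [[A B] /= [xA uB] AB] :=
      near_mdist_gt (iter_continuous k f_cont) ek.
    exists (B, A `*` setT) => /=.
      by split=> //; exists (A, setT) => //; split=> //=; exact: filterT.
    move=> [u' [p q]] /= [Bu' [Ap _]] [/(_ k) + _].
    by rewrite leNgt (AB (p, u')).
  have [[A B] /= [yA uB] AB] :=
    near_mdist_gt (iter_continuous k finv_cont) ek.
  exists (B, setT `*` A) => /=.
    by split=> //; exists (setT, A) => //; split=> //=; exact: filterT.
  move=> [u' [p q]] /= [Bu' [_ Aq]] [_ /(_ k)].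
  by rewrite leNgt (AB (q, u')).
exists V => // pq Vpq u pu qu; apply: contrapT => nOu.
have := HV pq Vpq u; apply => //.
by move=> /interior_subset.
Qed.

Lemma bracket_continuous_l x y z (O : set M) : bracket x y z -> nbhs z O ->
  \forall p \near x, forall u, Ws p u -> Wu y u -> O u.
Proof.
move=> xyz Oz; have [[A B] /= [xA yB] AB] := bracket_continuous xyz Oz.
apply: filterS xA => p Ap; apply: (AB (p, y)); split=> //.
exact: nbhs_singleton yB.
Qed.

Lemma bracket_continuous_r x y z (O : set M) : bracket x y z -> nbhs z O ->
  \forall q \near y, forall u, Ws x u -> Wu q u -> O u.
Proof.
move=> xyz Oz; have [[A B] /= [xA yB] AB] := bracket_continuous xyz Oz.
apply: filterS yB => q Bq; apply: (AB (x, q)); split=> //.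
exact: nbhs_singleton xA.
Qed.

Lemma rint_Om A x : rint A x -> Om x.
Proof. by case. Qed.

Lemma rint_sub A x : rint A x -> A x.
Proof. by move=> [Omx Ax]; exact: (nbhs_singleton Ax Omx). Qed.

Lemma near_rint A x : rint A x -> \forall y \near x, Om y -> rint A y.
Proof.
move=> [Omx /nbhs_interior Ax]; apply: filterS Ax => y Ay Omy; split=> //.
Qed.

Lemma bracket_Ws A x y : rectangle f finv Om eps delta0 A -> A x -> A y ->
  Ws x y -> bracket x y y.
Proof.
move=> [_ _ rA] Ax Ay xy; have [z _ xyz] := rA x y Ax Ay.
by rewrite {2}(bracket_unique xyz xy (Wu_refl y)).
Qed.

Lemma bracket_Wu A x y : rectangle f finv Om eps delta0 A -> A x -> A y ->
  Wu x y -> bracket x y x.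
Proof.
move=> [_ _ rA] Ax Ay /Wu_sym xy; have [z _ xyz] := rA x y Ax Ay.
by rewrite {2}(bracket_unique xyz (Ws_refl x) xy).
Qed.

Lemma near_brackets x y : Om x -> Om y -> mdist x y < delta0 ->
  \forall p \near x, Om p -> exists2 u, Om u & bracket p y u.
Proof.
move=> Omx Omy xy; have d0 : 0 < delta0 - mdist x y by rewrite subr_gt0.
apply: filterS (near_mdist_lt x d0) => p xp Omp; apply: Om_brackets => //.
apply: le_lt_trans (metric_triangle p x y) _.
by rewrite (metric_sym p); move: xp; lra.
Qed.

Lemma near_brackets_r x y : Om x -> Om y -> mdist x y < delta0 ->
  \forall p \near y, Om p -> exists2 u, Om u & bracket x p u.
Proof.
move=> Omx Omy xy; have d0 : 0 < delta0 - mdist x y by rewrite subr_gt0.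
apply: filterS (near_mdist_lt y d0) => p xp Omp; apply: Om_brackets => //.
apply: le_lt_trans (metric_triangle x y p) _.
by move: xp; lra.
Qed.

(** The interior of a rectangle is a rectangle. Let p be a point of Om near z.
The bracket u of p and x is near that of z and x, which is x, so u is in A;
likewise the bracket v of y and p is near y, so v is in A. As p lies on the
stable set of u and on the unstable set of v, it is the bracket of u and v, so
p is in A. *)
Lemma rint_bracket A x y z : rectangle f finv Om eps delta0 A ->
  rint A x -> rint A y -> bracket x y z -> rint A z.
Proof.
move=> rA Ax Ay xyz; have [AOm dA brA] := rA.
have [Ax' Ay'] := (rint_sub Ax, rint_sub Ay).
have Az : A z.
  have [z' Az' xyz'] := brA x y Ax' Ay'.
  by have [xz yz] := bracket_in xyz; rewrite (bracket_unique xyz' xz yz).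
have [xz yz] := bracket_in xyz.
have zxx := bracket_Ws rA Az Ax' (Ws_sym xz).
have yzy := bracket_Wu rA Ay' Az yz.
have Adelta u v : A u -> A v -> mdist u v < delta0.
  by move=> Au Av; apply: le_lt_trans dA; exact: mdist_le_diam.
have n1 := near_brackets (AOm _ Az) (AOm _ Ax') (Adelta _ _ Az Ax').
have n2 := near_brackets_r (AOm _ Ay') (AOm _ Az) (Adelta _ _ Ay' Az).
have n3 := bracket_continuous_l zxx Ax.2.
have n4 := bracket_continuous_r yzy Ay.2.
split; first exact: AOm.
apply: filterS (filterI (filterI n1 n2) (filterI n3 n4)) => p.
move=> [[h1 h2] [h3 h4]] Omp.
have [u Omu pxu] := h1 Omp; have [v Omv ypv] := h2 Omp.
have [pu xu] := bracket_in pxu; have [yv pv] := bracket_in ypv.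
have [q Aq uvq] := brA u v (h3 u pu xu Omu) (h4 v yv pv Omv).
by rewrite (bracket_unique uvq (Ws_sym pu) (Wu_sym pv)).
Qed.

(** * Itineraries in a Markov partition *)

Context {m : nat}.
Variable P : 'I_m -> set M.
Hypothesis P_markov : markov_partition f finv Om eps delta0 P.

Lemma P_rectangle i : rectangle f finv Om eps delta0 (P i).
Proof. by case: P_markov => /(_ i) [[]]. Qed.

Lemma P_closed i : closed (P i).
Proof. by case: P_markov => /(_ i) [[]]. Qed.

(** A point p of Om near q lies on the stable set of the bracket u of p and x,
which is near x. So the Markov property can be used at u, and it brings f p into
P j. *)
Lemma rint_f_stable i j (x q : M) : rint (P i) x -> rint (P j) (f x) ->
  rint (P i) q -> Ws x q -> rint (P j) (f q).
Proof.
move=> ix jx iq xq.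
have qxx := bracket_Ws (P_rectangle i) (rint_sub iq) (rint_sub ix) (Ws_sym xq).
have nO : \forall u \near x, Om u -> rint (P i) u /\ rint (P j) (f u).
  have nj : \forall u \near x, Om (f u) -> rint (P j) (f u).
    exact: f_cont (near_rint jx).
  apply: filterS (filterI (near_rint ix) nj).
  by move=> u [iu ju] Omu; split; [exact: iu|apply: ju; exact: Om_f].
have n : \forall p \near q, Om p -> P j (f p).
  have iq2 : \forall p \near q, Om p -> P i p by exact: iq.2.
  apply: filterS (filterI iq2 (bracket_continuous_l qxx nO)) => p [ip HO] Omp.
  have [POm _ rP] := P_rectangle i.
  have [u iu pxu] := rP p x (ip Omp) (rint_sub ix).
  have [pu xu] := bracket_in pxu; have [iu' ju'] := HO u pu xu (POm u iu).
  have [_ _ _ /(_ i j u iu' ju')[_ Pij]] := P_markov.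
  have [] // := Pij (f p) _; exists p => //; split; [exact: Ws_sym|exact: ip].
split; first exact: Om_f (rint_Om iq).
have cq : finv w @[w --> f q] --> q by rewrite -{2}(fK q); exact: finv_cont.
have nw : \forall w \near f q, Om (finv w) -> P j (f (finv w)) by exact: cq n.
by apply: filterS nw => w Hw Omw; rewrite -(finvK w); apply: Hw; exact: Om_finv.
Qed.

(** The same argument for the inverse: a point p near f q lies on the unstable
set of the bracket u of f x and p, which is near f x, and the Markov property at
the preimage of u brings the preimage of p into P i. *)
Lemma rint_f_unstable i j (x q : M) : rint (P i) x -> rint (P j) (f x) ->
  rint (P j) (f q) -> Wu (f x) (f q) -> rint (P i) q.
Proof.
move=> ix jx jq xq.
have xqx := bracket_Wu (P_rectangle j) (rint_sub jx) (rint_sub jq) xq.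
have nO : \forall u \near f x, Om u -> rint (P i) (finv u) /\ rint (P j) u.
  have cx : finv w @[w --> f x] --> x by rewrite -{2}(fK x); exact: finv_cont.
  have ni : \forall u \near f x, Om (finv u) -> rint (P i) (finv u).
    exact: cx (near_rint ix).
  apply: filterS (filterI ni (near_rint jx)).
  by move=> u [iu ju] Omu; split; [apply: iu; exact: Om_finv|exact: ju].
have n : \forall p \near f q, Om p -> P i (finv p).
  have jq2 : \forall p \near f q, Om p -> P j p by exact: jq.2.
  apply: filterS (filterI jq2 (bracket_continuous_r xqx nO)) => p [jp HO] Omp.
  have [POm _ rP] := P_rectangle j.
  have [u ju xpu] := rP (f x) p (rint_sub jx) (jp Omp).
  have [xu pu] := bracket_in xpu; have [iu' ju'] := HO u xu pu (POm u ju).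
  rewrite -(finvK u) in ju'.
  have [_ _ _ /(_ i j _ iu' ju')[Pij _]] := P_markov.
  have [|p' [_ ip'] <-] := Pij p; last by rewrite fK.
  by split; [rewrite finvK; exact: Wu_sym|exact: jp].
split; first by rewrite -(fK q); apply: Om_finv; exact: rint_Om jq.
have nw : \forall w \near q, Om (f w) -> P i (finv (f w)) by exact: f_cont n.
apply: filterS nw => w Hw Omw.
by rewrite -(fK w); apply: Hw; exact: Om_f.
Qed.

Definition itinerary (w : nat -> 'I_m) (k : nat) (x : M) : Prop :=
  forall j, (j <= k)%N -> rint (P (w j)) (iter j f x).

Lemma itinerary_stable w k x q : itinerary w k x -> rint (P (w 0%N)) q ->
  Ws x q -> itinerary w k q.
Proof.
move=> wx wq xq; elim=> [//|j IH] jk.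
apply: rint_f_stable (wx _ jk) (IH (ltnW jk)) _; last exact: Ws_iter.
exact: wx (ltnW jk).
Qed.

Lemma itinerary_unstable w k x q : itinerary w k x ->
  rint (P (w k)) (iter k f q) -> Wu (iter k f x) (iter k f q) ->
  itinerary w k q.
Proof.
move=> wx wq xq j jk; rewrite -(subKn jk).
elim: (k - j)%N (leq_subr j k) => [|d IH] dk; first by rewrite subn0.
have kd : (k - d = (k - d.+1).+1)%N by rewrite subnSK.
have := IH (ltnW dk); have := wx (k - d.+1)%N (leq_subr _ _).
have := wx (k - d)%N (leq_subr _ _); rewrite kd /= => wx1 wx0 wq1.
apply: rint_f_unstable wx0 wx1 wq1 _.
rewrite -!iterS -kd -[X in Wu X _](iter_fK d) -[X in Wu _ X](iter_fK d) -!iterD.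
by rewrite subnKC ?(ltnW dk)//; exact: Wu_iter.
Qed.

Definition transition : rel 'I_m :=
  fun i j => `[< rint (P i) `&` f @^-1` rint (P j) !=set0 >].

(** A point y following the word so far and a point x that makes the next
transition are glued: the bracket q of x and of the current image of y makes the
transition, being on the stable set of x, and its past follows that of y, being
on the unstable set of the image of y. *)
Lemma itinerary_exists w k : (0 < k)%N ->
  (forall j, (j < k)%N -> transition (w j) (w j.+1)) -> exists x, itinerary w k x.
Proof.
case: k => // k _; elim: k => [|k IH] tw.
  by have /asboolP[x [x0 x1]] := tw 0%N isT; exists x => -[|[|]].
have [|y wy] := IH; first by move=> j jk; apply: tw; exact: ltnW.
have /asboolP[x [/= xk xk1]] := tw k.+1 (ltnSn _).
have yk := wy _ (leqnn k.+1).
have [_ _ rP] := P_rectangle (w k.+1).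
have [q _ xyq] := rP x _ (rint_sub xk) (rint_sub yk).
have qk := rint_bracket (P_rectangle _) xk yk xyq.
have [xq yq] := bracket_in xyq.
exists (iter k.+1 finv q) => j; rewrite leq_eqVlt => /predU1P[->|jk].
  rewrite iterS iter_finvK.
  exact: rint_f_stable xk xk1 qk xq.
by apply: (itinerary_unstable wy); rewrite ?iter_finvK.
Qed.

(** With this gap, a point in a common rectangle with x' is eps-close to every
point that is eta-close to x'. *)
Lemma diam_gap : exists2 eta : R, 0 < eta & forall i, diam (P i) + eta <= eps.
Proof.
pose D := \big[Num.max/0]_i diam (P i).
have Deps : D < eps by apply: bigmax_lt => // i _; case: P_markov => /(_ i) [].
exists (eps - D); first by rewrite subr_gt0.
by move=> i; rewrite addrCA -[leRHS]addr0 lerD2l subr_le0 le_bigmax.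
Qed.

(** The bracket z of x and x' follows w. The bracket u of the k-th images of x
and x' is the k-th image of a point v that follows w'. Up to time k the point v
is in the same rectangles as x', which is eta-close to x; so v is eps-close to x
at all future times, hence it is z. A point in the interiors of the rectangles
of both words forces them to agree. *)
Lemma itinerary_separated (eta : R) w w' k x x' :
  (forall i, diam (P i) + eta <= eps) ->
  itinerary w k x -> itinerary w' k x' -> w 0%N = w' 0%N -> w k = w' k ->
  (forall j, (j <= k)%N -> mdist (iter j f x) (iter j f x') <= eta) ->
  forall j, (j <= k)%N -> w j = w' j.
Proof.
move=> Peta wx wx' w0 wk xx'.
have [x0 x0'] := (wx 0%N isT, wx' 0%N isT); rewrite -w0 in x0'.
have [xk xk'] := (wx k (leqnn k), wx' k (leqnn k)); rewrite -wk in xk'.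
have [_ _ rP0] := P_rectangle (w 0%N); have [_ _ rPk] := P_rectangle (w k).
have [z _ zE] := rP0 _ _ (rint_sub x0) (rint_sub x0').
have [u _ uE] := rPk _ _ (rint_sub xk) (rint_sub xk').
have [xz xz'] := bracket_in zE; have [xu xu'] := bracket_in uE.
have wz : itinerary w k z.
  apply: itinerary_stable wx _ xz.
  exact: rint_bracket (P_rectangle _) x0 x0' zE.
(* By uniqueness of brackets v will turn out to be z. *)
pose v := iter k finv u.
have wv : itinerary w' k v.
  apply: (itinerary_unstable wx'); rewrite iter_finvK// -wk.
  exact: rint_bracket (P_rectangle _) xk xk' uE.
have vz : v = z.
  apply: bracket_unique zE _ _.
    move=> j; have [jk|kj] := leqP j k.
      apply: le_trans (metric_triangle _ (iter j f x') _) _.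
      apply: le_trans (Peta (w' j)); rewrite addrC lerD ?xx'//.
      by apply: mdist_le_diam => //; apply: rint_sub; [exact: wx'|exact: wv].
    have -> : iter j f v = iter (j - k) f u.
      by rewrite -[in LHS](subnK (ltnW kj)) iterD iter_finvK.
    have -> : iter j f x = iter (j - k) f (iter k f x).
      by rewrite -iterD subnK// ltnW.
    exact: xu.
  by rewrite /= -(iter_fK k x'); exact: Wu_iter.
move=> j jk; apply: contrapT => /eqP ww'.
have [_ _ /(_ _ _ ww') P0 _] := P_markov.
have : (rint (P (w j)) `&` rint (P (w' j))) (iter j f z).
  by split; [exact: wz|rewrite -vz; exact: wv].
by rewrite P0.
Qed.

(** A finite intersection of dense open subsets of Om is dense; openness is
carried along in the conclusion to make the induction go through. *)
Lemma dense_itineraries k x (V : set M) : Om x -> nbhs x V ->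
  exists y, Om y /\ \forall y' \near y, Om y' ->
    V y' /\ forall j, (j < k)%N -> exists i, rint (P i) (iter j f y').
Proof.
move=> Omx Vx; elim: k => [|k [y [Omy ny]]].
  exists x; split=> //; apply: filterS (nbhs_interior Vx) => y Vy _; split=> //.
  exact: nbhs_singleton.
have [Pprop OmP _ _] := P_markov.
have := Om_iter k Omy; rewrite {1}OmP => -[i _ Piy].
have [[_ _ Pi] _] := Pprop i.
move: Piy; rewrite {1}Pi => cl.
have cy : iter k finv w @[w --> iter k f y] --> y.
  by rewrite -{2}(iter_fK k y); exact: (iter_continuous k finv_cont).
have /cl[w [iw nw]] := cy _ (nbhs_interior ny).
exists (iter k finv w); split; first exact/Om_iter_finv/(rint_Om iw).
have nw' : \forall y' \near iter k finv w,
    Om (iter k f y') -> rint (P i) (iter k f y').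
  have cw : iter k f y' @[y' --> iter k finv w] --> w.
    by rewrite -{2}(iter_finvK k w); exact: (iter_continuous k f_cont).
  exact: cw (near_rint iw).
apply: filterS (filterI nw nw') => y' [h1 h2] Omy'; have [Vy' jy'] := h1 Omy'.
split=> // j; rewrite ltnS leq_eqVlt => /predU1P[->|]; last exact: jy'.
by exists i; apply: h2; exact: Om_iter.
Qed.

Lemma itinerary_near k x (V : set M) : Om x -> nbhs x V ->
  exists y w, [/\ Om y, V y & itinerary w k y].
Proof.
move=> Omx Vx; have [y [Omy ny]] := dense_itineraries k.+1 Omx Vx.
have [Vy iy] := nbhs_singleton ny Omy.
have [i0 _] := iy 0%N isT.
have /choice[w wP] j : exists i, (j <= k)%N -> rint (P i) (iter j f y).
  have [jk|jk] := leqP j k; last by exists i0.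
  by have [i iyj] := iy j jk; exists i.
by exists y, w.
Qed.

Lemma itinerary_transition w k x j : itinerary w k x -> (j < k)%N ->
  transition (w j) (w j.+1).
Proof.
by move=> wx jk; apply/asboolP; exists (iter j f x); split;
  [exact: wx (ltnW jk)|exact: wx jk].
Qed.

Lemma transition_extends i j : transition i j ->
  (exists h, transition h i) /\ (exists h, transition j h).
Proof.
move=> /asboolP[x [ix /= jx]]; split.
  have nx : \forall y \near finv x, Om (f y) -> rint (P i) (f y).
    have cx : f y @[y --> finv x] --> x by rewrite -{2}(finvK x); exact: f_cont.
    exact: cx (near_rint ix).
  have [y [w [Omy iy wy]]] := itinerary_near 0 (Om_finv (rint_Om ix)) nx.
  exists (w 0%N); apply/asboolP; exists y; split; first exact: (wy 0%N isT).
  by apply: iy; exact: Om_f.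
have [y [w [Omy jy wy]]] := itinerary_near 1 (rint_Om jx) (near_rint jx).
exists (w 1%N); apply/asboolP; exists y; split; first exact: jy.
exact: (wy 1%N isT).
Qed.

Lemma transition_nonempty : exists i j, transition i j.
Proof.
have [x Omx] := Om_neq0; have [y [w [_ _ wy]]] := itinerary_near 1 Omx filterT.
by exists (w 0%N), (w 1%N); exact: (itinerary_transition wy).
Qed.

Variable i0 : 'I_m.

Lemma near_all_seq (T : eqType) (s : seq T) (x : M) (D : T -> M -> Prop) :
  (forall t, t \in s -> \forall y \near x, D t y) ->
  \forall y \near x, forall t, t \in s -> D t y.
Proof.
elim: s => [|t s IH] H; first by apply: filterE => y t.
apply: filterS (filterI (H t (mem_head _ _)) (IH _)) => [y [Dt Ds] t'|t' t's].
  by rewrite inE => /predU1P[->//|]; exact: Ds.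
by apply: H; rewrite inE t's orbT.
Qed.

(** If every word failed at x then, the rectangles being closed and the words
finitely many, every word would fail at all points near x, including one with
an itinerary in the interiors. *)
Lemma itinerary_cover k x : Om x ->
  exists2 w, w \in words transition k & follows f i0 P k w x.
Proof.
move=> Omx; apply: contrapT => nw.
have [] := @itinerary_near k x [set y | forall w, w \in words transition k ->
    exists2 j, (j <= k)%N & ~ P (nth i0 w j) (iter j f y)] Omx.
  apply: near_all_seq => w wk.
  have : ~ follows f i0 P k w x by move=> wx; apply: nw; exists w.
  move=> /existsNP[j /not_implyP[jk nPj]].
  have oP : open (~` P (nth i0 w j)) by rewrite openC; exact: P_closed.
  have nj : \forall y \near x, ~ P (nth i0 w j) (iter j f y).
    have cx : iter j f y @[y --> x] --> iter j f x by exact: iter_continuous.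
    exact: cx (open_nbhs_nbhs (conj oP nPj)).
  by apply: filterS nj => y nPy; exists j.
move=> y [w [_ bad wy]].
have wk : mkseq w k.+1 \in words transition k.
  rewrite mem_words size_mkseq eqxx; apply/(sortedP i0) => j.
  rewrite size_mkseq => jk; rewrite !nth_mkseq ?(ltnW jk)//.
  exact: itinerary_transition wy jk.
have [j jk] := bad _ wk; apply; rewrite nth_mkseq//; apply: rint_sub; exact: wy.
Qed.

Lemma compact_Om : compact Om.
Proof. exact: subclosed_compact M_compact _. Qed.

(** By expansiveness, codes that agree on the window from -L to L determine an
element of the cover; the window is moved to start at 0. *)
Lemma markov_generates U : open_cover Om U -> exists s L, forall x, Om x ->
  exists2 B, U B & forall y, Om y -> same_code f P L x y -> B (iter s f y).
Proof.
move=> UOm.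
pose E L x y := forall j, (j <= L)%N ->
  mdist (iter j f x) (iter j f y) <= eps /\
  mdist (iter j finv x) (iter j finv y) <= eps.
have [|L HL] := @generator_of_separation _ _ E compact_Om _ U UOm.
  move=> x y Omx Omy xy; have : ~ (Ws x y /\ Wu x y).
    by move=> [sxy uxy]; apply: xy; exact: expansive.
  move=> /not_andP[] /existsNP[k /negP]; rewrite -ltNge => ek; exists k.
    apply: filterS (near_mdist_gt (iter_continuous k f_cont) ek).
    by move=> [x' y'] /= lt L kL /(_ k kL)[+ _]; rewrite leNgt lt.
  apply: filterS (near_mdist_gt (iter_continuous k finv_cont) ek).
  by move=> [x' y'] /= lt L kL /(_ k kL)[_ +]; rewrite leNgt lt.
have close j x y : same_code f P (L + L) x y -> (j <= L + L)%N ->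
    mdist (iter j f x) (iter j f y) <= eps.
  move=> xy jL; have [i [ix iy]] := xy j jL.
  apply: le_trans (mdist_le_diam M_compact ix iy) _.
  by case: P_markov => /(_ i) [_ /ltW].
exists L, (L + L)%N => x Omx.
have [B UB HB] := HL _ (Om_iter L Omx); exists B => // y Omy xy.
apply: HB; first exact: Om_iter.
move=> j jL; rewrite -!iterD; split.
  by apply: close => //; rewrite leq_add2r.
rewrite -(subnKC jL) !iterD !iter_fK; apply: close => //.
by rewrite (leq_trans (leq_subr _ _))// leq_addl.
Qed.

Lemma markov_coding : coding f Om transition i0 P (fun i => rint (P i)).
Proof.
split.
- exact: Om_neq0.
- exact: f_Om.
- exact: itinerary_cover.
- exact: markov_generates.
- move=> k w k0; rewrite mem_words => /andP[/eqP sw /(sortedP i0) tw].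
  have [|x wx] := @itinerary_exists (nth i0 w) k k0.
    by move=> j jk; apply: tw; rewrite sw.
  by exists x => //; exact: (rint_Om (wx 0%N isT)).
- have [eta eta0 Peta] := diam_gap.
  exists [set B | open B /\ forall x y, B x -> B y -> mdist x y <= eta].
    split; first by move=> B [].
    have eta20 : 0 < eta / 2 by rewrite divr_gt0.
    move=> x Omx; exists (ball x (eta / 2))°; last first.
      exact: nbhs_singleton (nbhs_interior (nbhsx_ballx _ _ eta20)).
    split; first exact: open_interior.
    move=> y z /interior_subset + /interior_subset.
    rewrite ballEmdist /= => xy xz.
    apply: le_trans (metric_triangle y x z) _.
    by rewrite metric_sym; lra.
  move=> k w w' x x' wk wk' _ _ wx wx' w0 wkk Vx.
  move: wk wk'; rewrite !mem_words => /andP[/eqP sw _] /andP[/eqP sw' _].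
  apply: (@eq_from_nth _ i0) => [|j]; rewrite sw ?sw'// => jk.
  apply: (itinerary_separated Peta wx wx') => // h hk.
  by have [B [_ HB] [Bx Bx']] := Vx h hk; exact: HB.
Qed.

End MarkovPartition.

(** * Equality of the entropies *)

Lemma word_growth (R : realType) m (e : rel 'I_m.+1) (A : 'M[R]_m.+1) :
  (forall i j, A i j = (e i j)%:R) ->
  (forall mu, 0 < mu -> spectral_radius A < mu -> exists C, forall k,
    (size (words e k))%:R <= C * mu ^+ k) /\
  (forall mu, 0 <= mu < spectral_radius A -> forall k,
    mu ^+ k <= (size (words e k))%:R).
Proof.
move=> Ae; split=> [mu mu0 rhomu|mu mu0rho k].
  have [C HC] := powers_upper_bound rhomu mu0.
  by exists C => k; rewrite (size_words _ Ae).
rewrite (size_words _ Ae); apply: powers_lower_bound => // i j.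
by rewrite Ae ler0n.
Qed.

Theorem theorem9p12 (R : realType) (n : nat) (M : metricType R)
    (S : smooth_structure R n M) (g : riemannian_metric S)
    (r : nat) (f finv : M -> M) (Om : set M)
    (M_compact : compact [set: M])
    (M_dist : mdist_is_riemannian g)
    (r_ge1 : (1 <= r)%N)
    (f_diffeo : Cr_diffeo S r f finv)
    (f_axiomA : axiomA g f finv)
    (Om_basic : basic_set f Om)
    (Om_mixing : mixing_on f Om) :
  exists2 eps0 : R, 0 < eps0 &
    forall eps delta0 : R, 0 < eps <= eps0 -> 0 < delta0 ->
      has_brackets f finv Om eps delta0 ->
    forall (m : nat) (P : 'I_m -> set M),
      markov_partition f finv Om eps delta0 P ->
    let A := transition_matrix f Om P in
      h_top R f Om = h_top R (@seq_shift m) (Sigma A) /\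
      h_top R (@seq_shift m) (Sigma A) = (ln (spectral_radius A))%:E.
Proof.
(* Uniqueness of brackets at scale eps provides expansiveness at that scale. *)
exists 1 => // eps delta0 /andP[eps0 _] delta0_gt0 Om_br [|m] P P_markov A.
  (* Without rectangles, the basic set would be empty. *)
  have [k [B [i [[_ _ /(_ i)[[x Bx] _ _ _]] OmB]]]] := Om_basic.
  have [_ OmP _ _] := P_markov.
  by move: Bx; rewrite -OmB OmP => -[[]].
have [fK finvK [f_cont _] [finv_cont _]] := f_diffeo.
have [Om_neq0 Om_closed f_Om] : [/\ Om !=set0, closed Om & f @` Om = Om].
  by have [k [B [i [[_ _ /(_ i)[? ? ? _]] ->]]]] := Om_basic.
pose e := transition f Om P.
have Ae i j : A i j = (e i j)%:R by rewrite mxE.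
have [up low] := word_growth Ae.
have hOm : h_top R f Om = (ln (spectral_radius A))%:E.
  apply: coding_entropy up low.
  exact: (markov_coding M_compact fK finvK f_cont finv_cont Om_neq0 Om_closed
    f_Om eps0 delta0_gt0 Om_br P_markov ord0).
have hSig : h_top R (@seq_shift m.+1) (Sigma A) = (ln (spectral_radius A))%:E.
  have -> : Sigma A = [set a | forall z : int, e (a z) (a (z + 1))].
    apply/seteqP; split=> a Sa z; have := Sa z; rewrite Ae.
      by case: (e _ _) => // /eqP; rewrite eq_sym oner_eq0.
    by move=> ->.
  apply: coding_entropy up low; apply: (symbolic_coding ord0).
    exact: (transition_extends fK finvK f_cont finv_cont f_Om P_markov).
  exact: (transition_nonempty fK finvK f_cont finv_cont Om_neq0 f_Om P_markov).
by split=> //; rewrite hOm hSig.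
Qed.
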